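(* Let $Q\subset\mathbb{R}^n$ be convex and closed, let $f$ be weakly $\beta$-quasiconvex on $Q$ for some $\beta\in(0,1]$, let $X_*$ be the set of minimizers of $f$ on $Q$, $f^*=\min_{x\in Q}f(x)$, and suppose that $f$ has a sharp minimum: for some $\alpha>0$ $$f(x)-f^*\ge\alpha\min_{x_*\in X_*}\|x-x_*\|_2\qquad\forall x\in Q.$$ Let $x_0\in Q$ and $$x_{k+1}=Pr_Q\{x_k-h_k\nabla f(x_k)\},\qquad h_k=\frac{\beta(f(x_k)-f^* )}{\|\nabla f(x_k)\|_2^2},\qquad k\ge0,$$ where $\|\nabla f(x_k)\|_2\ne0$ for every $k\ge 0$. If, in addition, $f$ satisfies the Lipschitz condition with constant $M>0$, then the method converges at the rate of a geometric progression: $$\min_{x_*\in X_*}\|x_{k+1}-x_*\|_2^2\le\left(1-\frac{\alpha^2\beta^2}{M^2}\right)^{k+1}\min_{x_*\in X_*}\|x_0-x_*\|_2^2 .$$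
   Context: $\|\cdot\|_2$ is the Euclidean norm and $Pr_Q$ the Euclidean projection onto $Q$. The problem considered is $f(x)\to\min_{x\in Q}$. A subgradient $\nabla f(x)$ means an element of the Clarke subdifferential of $f$ at $x$, whose existence is assumed; if $f$ is differentiable at $x$, it is the usual gradient. The Lipschitz condition is $|f(x)-f(y)|\le M\|x-y\|_2$. $f$ is called weakly $\beta$-quasiconvex on $Q$ with respect to the minimizer $x_*$ of the problem if for arbitrary $x\in Q$ $$f(x_* )\ge f(x)+\frac1\beta\langle\nabla f(x),x_*-x\rangle ,$$ where $\nabla f(x)$ is an arbitrary subgradient of $f$ at $x$. The condition $\nabla f(x_k)\neq0$ is part of the description of the method (otherwise a solution has already been found). *)

(* Defs.v *)
From HB Require Import structures.
From mathcomp Require Import all_boot all_order all_algebra.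
From mathcomp Require Import all_classical all_reals all_analysis.

Set Implicit Arguments.
Unset Strict Implicit.
Unset Printing Implicit Defensive.

Import Order.TTheory GRing.Theory Num.Theory.
Import numFieldNormedType.Exports.

Local Open Scope classical_set_scope.
Local Open Scope ring_scope.

Section Euclidean.
Context {R : realType} {n : nat}.
Implicit Types (x y g v : 'rV[R]_n) (Q U : set 'rV[R]_n) (f : 'rV[R]_n -> R).

Definition dot x y : R := \sum_(i < n) x 0 i * y 0 i.

(* The library norm `|x| on 'rV[R]_n is the max norm; it is used here only
   through the topology, which is the Euclidean one. *)
Definition norm2 x : R := Num.sqrt (dot x x).

Definition lipschitz2_on U f (M : R) :=
  forall x y, U x -> U y -> `|f x - f y| <= M * norm2 (x - y).

Definition argmin Q f : set 'rV[R]_n :=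
  [set x | Q x /\ forall y, Q y -> f x <= f y].

(* The least element of A; the value 0 is junk, used only when A has none. *)
Definition minimum (A : set R) : R := xget 0 (A `&` lbound A).

Definition dist2 x Q : R := minimum [set norm2 (x - y) | y in Q].

(* Unique when Q is nonempty, closed and convex. *)
Definition proj_on Q x : 'rV[R]_n := xget x (argmin Q (fun y => norm2 (x - y))).

(* Clarke's generalized directional derivative:
   limsup of (f (y + t v) - f y) / t as y -> x and t -> 0 with t > 0. *)
Definition clarke_derivative f x v : \bar R :=
  limf_esup (fun p : 'rV[R]_n * R => ((f (p.1 + p.2 *: v) - f p.1) / p.2)%:E)
            (filter_prod (nbhs x) (nbhs (0 : R)^'+)).

Definition clarke_subdifferential f x : set 'rV[R]_n :=
  [set g | forall v, ((dot g v)%:E <= clarke_derivative f x v)%E].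

(* At a point of differentiability only the gradient counts as a subgradient,
   although the Clarke subdifferential may be larger there when f is not
   strictly differentiable. *)
Definition subgradient f x : set 'rV[R]_n :=
  [set g | clarke_subdifferential f x g /\
           (differentiable f x -> forall v, 'd f x v = dot g v)].

Definition weakly_quasiconvex (beta : R) Q f (xs : 'rV[R]_n) :=
  forall x g, Q x -> subgradient f x g ->
    f xs >= f x + beta^-1 * dot g (xs - x).

End Euclidean.

(* Main.v *)
Require Import Defs.
From HB Require Import structures.
From mathcomp Require Import all_boot all_order all_algebra.
From mathcomp Require Import all_classical all_reals all_analysis.
From mathcomp Require Import ring lra.

Set Implicit Arguments.
Unset Strict Implicit.
Unset Printing Implicit Defensive.

Import Order.TTheory GRing.Theory Num.Theory.
Import numFieldNormedType.Exports.

Local Open Scope classical_set_scope.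
Local Open Scope ring_scope.

(* Let xs be a minimizer nearest to x_k, d its distance and D = f(x_k) - f*.
   The projection does not increase the distance to xs, and quasiconvexity gives
   <g_k, x_k - xs> >= beta D, so the choice of h_k yields
     |x_{k+1} - xs|^2 <= d^2 - beta^2 D^2 / |g_k|^2.
   Sharpness gives D >= alpha d, and |g_k| <= M because the Clarke derivative of
   an M-Lipschitz function in the direction v is at most M |v|. *)

Section EuclideanFacts.
Context {R : realType} {n : nat}.
Implicit Types (x y z p g v : 'rV[R]_n) (A Q U : set 'rV[R]_n).

(** * Bilinearity of the inner product and continuity of the Euclidean norm *)

Lemma dotC x y : dot x y = dot y x.
Proof. by apply: eq_bigr => i _; rewrite mulrC. Qed.

Lemma dotDl x y z : dot (x + y) z = dot x z + dot y z.
Proof. by rewrite -big_split; apply: eq_bigr => i _; rewrite !mxE mulrDl. Qed.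

Lemma dotZl a x y : dot (a *: x) y = a * dot x y.
Proof.
by rewrite [RHS]big_distrr /=; apply: eq_bigr => i _; rewrite !mxE mulrA.
Qed.

Lemma dotNl x y : dot (- x) y = - dot x y.
Proof. by rewrite -scaleN1r dotZl mulN1r. Qed.

Lemma dotDr x y z : dot x (y + z) = dot x y + dot x z.
Proof. by rewrite ![dot x _]dotC dotDl. Qed.

Lemma dotNr x y : dot x (- y) = - dot x y.
Proof. by rewrite ![dot x _]dotC dotNl. Qed.

Lemma dotZr a x y : dot x (a *: y) = a * dot x y.
Proof. by rewrite ![dot x _]dotC dotZl. Qed.

Lemma dotxx_ge0 x : 0 <= dot x x.
Proof. by apply: sumr_ge0 => i _; rewrite -expr2 sqr_ge0. Qed.

Lemma norm2_ge0 x : 0 <= norm2 x.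
Proof. exact: sqrtr_ge0. Qed.

Lemma norm2_sqr x : norm2 x ^+ 2 = dot x x.
Proof. by rewrite sqr_sqrtr ?dotxx_ge0. Qed.

Lemma ler_norm2 x y : (norm2 x <= norm2 y) = (dot x x <= dot y y).
Proof. by rewrite ler_sqrt ?dotxx_ge0. Qed.

Lemma norm2Z a x : norm2 (a *: x) = `|a| * norm2 x.
Proof.
by rewrite /norm2 dotZl dotZr mulrA -expr2 sqrtrM ?sqr_ge0 // sqrtr_sqr.
Qed.

Lemma dotB x y : dot (x - y) (x - y) = dot x x - 2 * dot x y + dot y y.
Proof. by rewrite !(dotDl, dotDr, dotNl, dotNr) (dotC y x); ring. Qed.

(** Turns Euclidean bounds into bounds for the max norm, in which [bounded_set] is expressed. *)
Lemma norm_le_norm2 x : `|x| <= norm2 x.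
Proof.
rewrite [leLHS]/Num.norm /= mx_normrE; apply: bigmax_le => [|[i j] _ /=].
  exact: norm2_ge0.
rewrite ord1 -sqrtr_sqr ler_wsqrtr // /dot (bigD1 j) //= expr2 lerDl.
by apply: sumr_ge0 => k _; rewrite -expr2 sqr_ge0.
Qed.

Lemma norm2_continuous : continuous (@norm2 R n).
Proof.
move=> x; apply: continuous_comp; last exact: sqrt_continuous.
move: x; apply: continuous_big => [|i _ x]; first exact: add_continuous.
by apply: (@continuousM R 'rV[R]_n); exact: coord_continuous.
Qed.

Lemma norm2_subl_continuous p : continuous (fun y => norm2 (p - y)).
Proof.
move=> y.
have subc : {for y, continuous (fun z : 'rV[R]_n => p - z)}.
  apply: (@continuousB R 'rV[R]_n 'rV[R]_n); first exact: cst_continuous.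
  exact: cvg_id.
exact: (continuous_comp subc (@norm2_continuous _)).
Qed.

(** * Nearest points, distances and projections *)

Lemma minimumP (S : set R) m : (S `&` lbound S) m -> minimum S = m.
Proof.
move=> [Sm mS]; apply: xget_unique => // y [Sy yS].
by apply/eqP; rewrite eq_le yS// mS.
Qed.

Lemma minimum_argmin Q (f : 'rV[R]_n -> R) x :
  argmin Q f x -> minimum [set f y | y in Q] = f x.
Proof.
move=> [Qx xQ]; apply: minimumP; split; first by exists x.
by move=> _ [y Qy <-]; exact: xQ.
Qed.

(** Only points of [A] no farther from [p] than a fixed [a] compete. They form a closed bounded set,
    hence a compact one, on which the continuous distance attains its minimum. *)
Lemma closest_point_exists A p : closed A -> A !=set0 ->
  exists y, argmin A (fun y => norm2 (p - y)) y.
Proof.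
move=> Acl [a Aa]; pose d y := norm2 (p - y).
pose B := A `&` [set y | d y <= d a].
have Bcl : closed B.
  apply: closedI => //.
  rewrite (_ : mkset _ = d @^-1` [set r | r <= d a]) //.
  apply: preimage_closed => [z _|]; first exact: norm2_subl_continuous.
  exact: closed_le.
have Bbd : bounded_set B.
  exists (`|p| + d a); split; first exact: num_real.
  move=> M /ltW dM y [_ /= yda]; apply: le_trans dM.
  rewrite -[y in `|y|](subKr p) (le_trans (ler_normB _ _))// lerD2l.
  exact: le_trans (norm_le_norm2 _) yda.
have [|c /set_mem[Ac ca] cB] := EVT_min_rV _ (bounded_closed_compact Bbd Bcl)
    (continuous_subspaceT (@norm2_subl_continuous p)).
  by exists a; split => /=.
exists c; split => // y Ay; have [ya|/ltW ay] := leP (d y) (d a).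
  by apply: cB; rewrite inE; split.
exact: le_trans ca ay.
Qed.

(** Guarantees that [dist2] is a true distance here and not the default value of [minimum]. *)
Lemma dist2_attained A p : closed A -> A !=set0 ->
  exists2 y, A y & dist2 p A = norm2 (p - y).
Proof.
move=> Acl A0; have [y ay] := closest_point_exists p Acl A0.
by exists y; [case: ay|exact: (minimum_argmin ay)].
Qed.

Lemma dist2_le A p y : closed A -> A y -> dist2 p A <= norm2 (p - y).
Proof.
move=> Acl Ay.
have [|c [Ac cA]] := closest_point_exists p Acl; first by exists y.
by rewrite /dist2 (minimum_argmin (conj Ac cA)); exact: cA.
Qed.

Lemma dist2_ge0 A p : closed A -> A !=set0 -> 0 <= dist2 p A.
Proof.
by move=> Acl A0; have [y _ ->] := dist2_attained p Acl A0; exact: norm2_ge0.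
Qed.

Lemma proj_onP Q p : closed Q -> Q !=set0 ->
  argmin Q (fun y => norm2 (p - y)) (proj_on Q p).
Proof. by move=> Qcl Q0; exact: xgetPex (closest_point_exists p Qcl Q0). Qed.

Lemma convex_set_segment Q y z (t : R) : convex_set Q -> Q y -> Q z ->
  0 <= t -> t <= 1 -> Q (y + t *: (z - y)).
Proof.
move=> Qcv Qy Qz t0 t1.
have /set_mem := Qcv z y (Itv01 t0 t1) (mem_set Qz) (mem_set Qy).
suff -> : y + t *: (z - y) = t *: z + (1 - t) *: y by [].
by rewrite scalerBl scale1r scalerBr addrCA.
Qed.

(** If [c] were positive, a short move from [y] towards [z] would stay in [Q] and come strictly
    closer to [p]. *)
Lemma closest_point_obtuse Q p y z : convex_set Q ->
  argmin Q (fun y => norm2 (p - y)) y -> Q z -> dot (p - y) (z - y) <= 0.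
Proof.
move=> Qcv [Qy ymin] Qz; set c := dot _ _; pose b := dot (z - y) (z - y).
have b0 : 0 <= b by exact: dotxx_ge0.
rewrite leNgt; apply/negP => c0.
have bc0 : 0 < b + c by rewrite ltr_wpDl.
(* The unconstrained best step [c / b] could exceed 1. With [b + c] below, [t] stays in (0, 1] and
   [t * b = c - t * c < 2 * c], so the squared distance still drops. *)
pose t := c / (b + c).
have t0 : 0 < t by rewrite divr_gt0.
have t1 : t <= 1 by rewrite ler_pdivrMr // mul1r lerDr.
have := ymin _ (convex_set_segment Qcv Qy Qz (ltW t0) t1).
rewrite ler_norm2 opprD addrA (dotB (p - y) (t *: _)) dotZl !dotZr -/c -/b.
have tbc : t * (b + c) = c by rewrite divfK // gt_eqF.
nra.
Qed.

(** With [y] the projection, expanding the square of [(p - y) - (z - y)] leaves a cross term of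
    favourable sign by the obtuse angle at [y]. *)
Lemma proj_on_contract Q p z : convex_set Q -> closed Q -> Q z ->
  norm2 (proj_on Q p - z) <= norm2 (p - z).
Proof.
move=> Qcv Qcl Qz; have Q0 : Q !=set0 by exists z.
have /(closest_point_obtuse Qcv)/(_ Qz) := proj_onP p Qcl Q0.
set y := proj_on Q p => obt; rewrite ler_norm2.
have -> : p - z = p - y - (z - y) by rewrite opprB addrA subrK.
rewrite -[y - z]opprB dotNl dotNr opprK dotB.
by have := dotxx_ge0 (p - y); lra.
Qed.

(** * Lipschitz bounds and the one-step estimate *)

(** A minimizer [z] within [e / M] of the limit point [x] gives [f x <= f z + e <= f y + e].
    Closedness is what makes the distance to the minimizers attained. *)
Lemma lipschitz2_argmin_closed Q U (f : 'rV[R]_n -> R) M : 0 < M ->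
  closed Q -> Q `<=` U -> lipschitz2_on U f M -> closed (argmin Q f).
Proof.
move=> M0 Qcl QU flip x clx.
have Qx : Q x by apply: Qcl; apply: closureS clx => y [].
split=> // y Qy; apply/ler_addgt0Pl => e e0.
have /clx[z [[Qz zmin] /= xz]] : nbhs x [set z | norm2 (x - z) < e / M].
  apply: (@norm2_subl_continuous x x [set r | r < e / M]); apply: lt_nbhsl.
  by rewrite subrr -(scale0r 0) norm2Z normr0 mul0r divr_gt0.
have := flip x z (QU _ Qx) (QU _ Qz).
move: xz; rewrite ltr_pdivlMr // mulrC => xz /ler_normlP[_ +].
have := zmin _ Qy; lra.
Qed.

(** The upper limit is an infimum, over sets of the filter, of suprema. It is therefore enough to
    bound the quotients on the single set [V], where both points lie in [U] and the Lipschitz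
    condition applies. *)
Lemma clarke_derivative_le U (f : 'rV[R]_n -> R) M x v : open U -> U x ->
  lipschitz2_on U f M -> (clarke_derivative f x v <= (M * norm2 v)%:E)%E.
Proof.
move=> Uo Ux flip.
pose F := filter_prod (nbhs x) (nbhs (0 : R)^'+).
pose V := [set p : 'rV[R]_n * R | [/\ U p.1, U (p.1 + p.2 *: v) & 0 < p.2]].
have FV : F V.
  have nU : nbhs x U by exact: open_nbhs_nbhs.
  have F1 : p.1 @[p --> F] --> x by exact: cvg_fst.
  have F2 : p.2 @[p --> F] --> (0 : R)^'+ by exact: cvg_snd.
  have F3 : p.1 + p.2 *: v @[p --> F] --> x.
    rewrite -[X in _ --> X]addr0 -(scale0r v).
    have F2' : p.2 @[p --> F] --> (0 : R).
      by apply: cvg_trans F2 _; exact: cvg_within.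
    by apply: cvgD => //; exact: (@cvgZr_tmp R 'rV[R]_n _ F _ _ _ v F2').
  near=> p; split.
  - by near: p; exact: (F1 _ nU).
  - by near: p; exact: (F3 _ nU).
  - by near: p; exact: (F2 _ (nbhs_right_gt (0 : R))).
apply: le_trans (ereal_inf_lbound _) _; first by exists V.
apply: ge_ereal_sup => _ [[y t] [/= Uy Uyt t0] <-].
rewrite lee_fin ler_pdivrMr //; apply: le_trans (ler_norm _) _.
apply: le_trans (flip _ _ Uyt Uy) _.
by rewrite addrAC subrr add0r norm2Z gtr0_norm // -mulrA (mulrC t).
Unshelve. all: by end_near.
Qed.

(** Testing the subgradient in its own direction [g] gives [norm2 g ^+ 2 <= M * norm2 g]. *)
Lemma clarke_subdifferential_norm2_le U (f : 'rV[R]_n -> R) M x g :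
  open U -> U x -> 0 <= M -> lipschitz2_on U f M ->
  clarke_subdifferential f x g -> norm2 g <= M.
Proof.
move=> Uo Ux M0 flip /(_ g) gg.
have := le_trans gg (clarke_derivative_le g Uo Ux flip).
rewrite lee_fin -norm2_sqr expr2.
have := norm2_ge0 g; rewrite le_eqVlt => /predU1P[<- //|g0].
by rewrite ler_pM2r.
Qed.

(* The step length h minimizes the bound d^2 - 2 h beta (fx - fs) + h^2 |g|^2
   on the squared distance, and the minimum is d^2 - (beta (fx - fs) / |g|)^2. *)
Lemma polyak_step_le (alpha beta M fx fs h : R) x xs g :
  0 < alpha -> 0 < beta -> 0 < M -> 0 < norm2 g -> norm2 g <= M ->
  fx - fs >= alpha * norm2 (x - xs) -> fs >= fx + beta^-1 * dot g (xs - x) ->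
  h = beta * (fx - fs) / norm2 g ^+ 2 ->
  norm2 (x - h *: g - xs) ^+ 2 <=
    (1 - alpha ^+ 2 * beta ^+ 2 / M ^+ 2) * norm2 (x - xs) ^+ 2.
Proof.
move=> al0 be0 M0 g0 gM sharp wqc ->; set D := fx - fs in sharp *.
set G := norm2 g in g0 gM *; set d := norm2 (x - xs) in sharp *.
have d0 : 0 <= d by exact: norm2_ge0.
have D0 : 0 <= D by rewrite (le_trans _ sharp) // mulr_ge0 // ltW.
set t := beta * D / G ^+ 2.
have tG : t * G ^+ 2 = beta * D by rewrite divfK // expf_neq0 // gt_eqF.
have t0 : 0 <= t by rewrite divr_ge0 ?mulr_ge0 ?sqr_ge0 // ltW.
have gx : beta * D <= dot (x - xs) g.
  rewrite -ler_pdivlMl // dotC.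
  by move: wqc; rewrite -(opprB x xs) dotNr mulrN /D; lra.
have ratio : alpha * d / M <= D / G.
  apply: ler_pM; rewrite ?mulr_ge0 ?invr_ge0 ?(ltW al0) ?(ltW M0) //.
  by rewrite lef_pV2.
have ratio0 : 0 <= alpha * d / M by rewrite divr_ge0 ?mulr_ge0 // ltW.
have ratio2 : (alpha * d / M) ^+ 2 <= (D / G) ^+ 2.
  by rewrite lerXn2r ?nnegrE // (le_trans ratio0).
rewrite addrAC norm2_sqr dotB dotZl !dotZr -!norm2_sqr -/d -/G.
have -> : t * (t * G ^+ 2) = beta ^+ 2 * (D / G) ^+ 2.
  by rewrite tG /t !expr2; field; rewrite gt_eqF.
(* The cross term, which enters twice, gains at least this amount each time, while the quadratic
   term costs it once; one copy remains as the net decrease. *)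
have drop : beta ^+ 2 * (D / G) ^+ 2 <= t * dot (x - xs) g.
  have -> : beta ^+ 2 * (D / G) ^+ 2 = t * (beta * D).
    by rewrite /t; field; rewrite gt_eqF.
  exact: ler_wpM2l.
have := ler_wpM2l (sqr_ge0 beta) ratio2.
have -> : beta ^+ 2 * (alpha * d / M) ^+ 2
    = alpha ^+ 2 * beta ^+ 2 / M ^+ 2 * d ^+ 2.
  by field; rewrite gt_eqF.
lra.
Qed.

End EuclideanFacts.

(* U is an open set containing Q on which f is defined and M-Lipschitz (values
   of f outside U are irrelevant); it may be the whole space. *)
Theorem mainTheorem3 (R : realType) (n : nat) (Q U : set 'rV[R]_n)
    (f : 'rV[R]_n -> R) (alpha beta M fstar : R) (x g : nat -> 'rV[R]_n)
    (h : nat -> R)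
    (Q_convex : convex_set Q) (Q_closed : closed Q)
    (U_open : open U) (QU : Q `<=` U)
    (beta_gt0 : 0 < beta) (beta_le1 : beta <= 1)
    (Xs_nonempty : argmin Q f !=set0)
    (fstarE : fstar = minimum [set f y | y in Q])
    (f_wqc : forall xs, argmin Q f xs -> weakly_quasiconvex beta Q f xs)
    (alpha_gt0 : 0 < alpha)
    (f_sharp : forall y, Q y -> f y - fstar >= alpha * dist2 y (argmin Q f))
    (x0_in : Q (x 0%N))
    (g_subgrad : forall k, subgradient f (x k) (g k))
    (g_neq0 : forall k, norm2 (g k) != 0)
    (hE : forall k, h k = beta * (f (x k) - fstar) / norm2 (g k) ^+ 2)
    (xE : forall k, x k.+1 = proj_on Q (x k - h k *: g k))
    (M_gt0 : 0 < M) (f_lip : lipschitz2_on U f M)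
    (k : nat) :
  dist2 (x k.+1) (argmin Q f) ^+ 2 <=
    (1 - alpha ^+ 2 * beta ^+ 2 / M ^+ 2) ^+ k.+1
      * dist2 (x 0%N) (argmin Q f) ^+ 2.
Proof.
pose Xs := argmin Q f; pose q := 1 - alpha ^+ 2 * beta ^+ 2 / M ^+ 2.
have Xcl : closed Xs := lipschitz2_argmin_closed M_gt0 Q_closed QU f_lip.
have xQ j : Q (x j).
  case: j => [//|j]; rewrite xE.
  by have [] := proj_onP (x j - h j *: g j) Q_closed (ex_intro _ _ x0_in).
have d_ge0 j : 0 <= dist2 (x j) Xs by exact: dist2_ge0.
have contraction j : dist2 (x j.+1) Xs ^+ 2 <= q * dist2 (x j) Xs ^+ 2.
  (* The minimizer nearest to the current iterate also bounds the next distance from above, so it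
     need not be nearest to the next iterate. *)
  have [xs Xxs dE] := dist2_attained (x j) Xcl Xs_nonempty.
  have [Qxs _] := Xxs.
  apply: (@le_trans _ _ (norm2 (x j - h j *: g j - xs) ^+ 2)).
    rewrite lerXn2r ?nnegrE ?norm2_ge0 //.
    by apply: le_trans (dist2_le _ Xcl Xxs) _; rewrite xE proj_on_contract.
  have fsE : f xs = fstar by rewrite fstarE (minimum_argmin Xxs).
  have gM : norm2 (g j) <= M.
    have [gC _] := g_subgrad j.
    have Ux : U (x j) by exact: QU (xQ j).
    exact: (clarke_subdifferential_norm2_le U_open Ux (ltW M_gt0) f_lip gC).
  rewrite dE; apply: (polyak_step_le alpha_gt0 beta_gt0 M_gt0 _ gM _ _ (hE j)).
  - by rewrite lt_def g_neq0 norm2_ge0.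
  - by rewrite -dE; exact: f_sharp.
  - by rewrite -fsE; exact: f_wqc.
(* Multiplying the induction hypothesis by [q] preserves the inequality only for [0 <= q], hence the
   case split. *)
rewrite -/q -/Xs; have [q0|q0] := leP 0 q.
  elim: k => [|j IHj]; first by rewrite expr1; exact: contraction.
  by rewrite exprS -mulrA; apply: le_trans (contraction _) _; exact: ler_wpM2l.
(* A negative ratio q forces every iterate to be a minimizer. *)
have d0 j : dist2 (x j) Xs = 0.
  apply/eqP; rewrite -sqrf_eq0 eq_le sqr_ge0 andbT.
  by rewrite -(nmulr_rge0 _ q0) (le_trans (sqr_ge0 _) (contraction j)).
by rewrite !d0 expr0n /= mulr0.
Qed.
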